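(* Let $G$ be a finite simple graph without isolated vertices, with minimum degree $\delta$ and maximum degree $\Delta$, and let $a \in \mathbb{R}$. Then $$\Delta^{-2a} ISD_{-a}(G) \le ISD_a(G) \le \delta^{-2a} ISD_{-a}(G), \qquad \text{if } a>0,$$ $$\delta^{-2a} ISD_{-a}(G) \le ISD_a(G) \le \Delta^{-2a} ISD_{-a}(G), \qquad \text{if } a<0.$$ In each of these four bounds, equality is attained if and only if $G$ is regular.
   Context: Graphs are undirected, finite, nonempty, simple (no loops, no multiple edges), without isolated vertices, and not necessarily connected; so $1\le\delta\le\Delta<n$ where $n=|V(G)|$. $d_u$ denotes the degree of the vertex $u$, and $uv$ denotes the (unordered) edge joining $u$ and $v$; sums over $uv\in E(G)$ run once over each edge. For $a\in\mathbb{R}$ the variable inverse sum deg index is $$ISD_a(G)=\sum_{uv\in E(G)}\frac{1}{d_u^a+d_v^a}.$$ A graph is regular if all its vertices have the same degree. *)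

(* Defs.v *)
From mathcomp Require Import all_boot all_order all_algebra.
From mathcomp Require Import reals exp.

Set Implicit Arguments.
Unset Strict Implicit.
Unset Printing Implicit Defensive.

Import Order.TTheory GRing.Theory Num.Theory.

Local Open Scope ring_scope.

Definition simple_graph (T : finType) (e : rel T) : Prop :=
  [/\ (0 < #|T|)%N, symmetric e & irreflexive e].

Definition no_isolated (T : finType) (e : rel T) : Prop :=
  forall u : T, exists v : T, e u v.

Definition degree (T : finType) (e : rel T) (u : T) : nat :=
  #|[set v | e u v]|.

(* In a nonempty simple graph all degrees are < #|T|, so the default value #|T|
   of the iterated minimum plays no role. *)
Definition min_degree (T : finType) (e : rel T) : nat :=
  \big[minn/#|T|]_(u : T) degree e u.

Definition max_degree (T : finType) (e : rel T) : nat :=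
  (\max_(u : T) degree e u)%N.

Definition regular (T : finType) (e : rel T) : Prop :=
  forall u v : T, degree e u = degree e v.

(* An undirected edge uv is the two-element set [set u; v], so that each edge is
   counted once in a sum over [edges e]. *)
Definition edges (T : finType) (e : rel T) : {set {set T}} :=
  [set [set p.1; p.2] | p : T * T & e p.1 p.2].

(* For the edge f = [set u; v], with u != v, the inner sum is d_u^a + d_v^a. *)
Definition ISD (R : realType) (T : finType) (e : rel T) (a : R) : R :=
  \sum_(f in edges e) 1 / (\sum_(w in f) (degree e w)%:R `^ a).

(* Main.v *)
Require Import Defs.
From mathcomp Require Import all_boot all_order all_algebra.
From mathcomp Require Import reals exp ring.
Import Order.TTheory GRing.Theory Num.Theory.
Local Open Scope ring_scope.

(** The two indices are compared edge by edge.  Writing x and y for the degrees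
    of the ends of an edge,
      1 / (x^a + y^a) = x^(-a) y^(-a) / (x^(-a) + y^(-a)),
    so if m^(-a) is a lower bound of all the d_u^(-a), each term of [ISD e a] is
    at least m^(-2a) times the matching term of [ISD e (- a)], and is equal to
    it exactly when x^(-a) = y^(-a) = m^(-a).  Since every vertex lies on an
    edge, equality of the sums forces all degrees to be m when a <> 0
    ([ISD_lower_bound]).

    The remaining bounds are the same fact at the exponent -a, with the power
    of m moved to the other side ([ISD_upper_bound]).  The sign of a decides
    which of the two extreme degrees, both of which are attained, serves as m:
    x |-> x^(-a) is decreasing for a > 0 and increasing for a < 0. *)

Section DegreeBounds.

Set Implicit Arguments.
Unset Strict Implicit.

Variables (T : finType) (e : rel T).

Lemma degree_gt0 u : no_isolated e -> (0 < degree e u)%N.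
Proof.
by move=> /(_ u) [v euv]; apply/card_gt0P; exists v; rewrite inE.
Qed.

Lemma max_degree_ge u : (degree e u <= max_degree e)%N.
Proof. exact: (bigop.leq_bigmax u). Qed.

Lemma max_degree_attained :
  simple_graph e -> exists u, degree e u = max_degree e.
Proof.
case=> T_gt0 _ _; have [u Du] := bigop.eq_bigmax (degree e) T_gt0.
by exists u; rewrite /max_degree Du.
Qed.

Lemma min_degree_le u : (min_degree e <= degree e u)%N.
Proof.
rewrite /min_degree; have: u \in index_enum T by rewrite mem_index_enum.
elim: (index_enum T) => // v s IHs; rewrite inE big_cons geq_min.
by case/predU1P=> [-> | /IHs->]; rewrite ?leqnn ?orbT.
Qed.

Lemma min_degree_attained :
  simple_graph e -> exists u, degree e u = min_degree e.
Proof.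
case=> /card_gt0P[u0 _] _ _.
have [u _ u_min] := arg_minnP (degree e) (isT : predT u0).
exists u; apply/eqP; rewrite eqn_leq min_degree_le andbT.
rewrite /min_degree; elim/big_ind: _ => [|x y ux uy|v _].
(* The default value #|T| of the minimum is itself at least every degree. *)
- exact: max_card.
- by rewrite leq_min ux uy.
- exact: u_min.
Qed.

End DegreeBounds.

Lemma powR_inj_neq0 (R : realType) (r x y : R) :
  r != 0 -> 0 < x -> 0 < y -> x `^ r = y `^ r -> x = y.
Proof.
have pos s : 0 < s -> 0 < x -> 0 < y -> x `^ s = y `^ s -> x = y.
  by move=> s0 x0 y0; apply: powR_injective; rewrite ?nnegrE ?ltW.
rewrite neq_lt => /orP[r0 x0 y0 xy | /pos//].
by apply: (pos (- r)); rewrite ?oppr_gt0 // !powRN xy.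
Qed.

(** The elementary inequality behind every bound: the difference of the two
    sides is (x y - m^2) / (x + y). *)
Lemma leif_inv_sum (R : realType) (m x y : R) :
  0 < m -> m <= x -> m <= y ->
  m ^+ 2 * (1 / (x + y)) <= 1 / (x^-1 + y^-1)
    ?= iff ((x == m) && (y == m)).
Proof.
move=> m0 mx my.
have x0 : 0 < x := lt_le_trans m0 mx; have y0 : 0 < y := lt_le_trans m0 my.
have xy0 : 0 < x + y by rewrite addr_gt0.
have -> : 1 / (x^-1 + y^-1) = x * y * (1 / (x + y)).
  by field; rewrite !gt_eqF // addr_gt0.
have q0 : 0 < 1 / (x + y) by rewrite divr_gt0.
have le_mm : m ^+ 2 <= x * y by rewrite expr2 ler_pM // ltW.
split; first by rewrite ler_pM2r.
rewrite (inj_eq (mulIf (lt0r_neq0 q0))).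
apply/eqP/andP => [mxy | [/eqP-> /eqP->]]; last by rewrite expr2.
have le_m w z : m <= w -> m <= z -> m ^+ 2 = w * z -> w == m.
  move=> mw mz wz; rewrite eq_le mw andbT -(ler_pM2r m0) -expr2 wz.
  by rewrite ler_pM2l // (lt_le_trans m0 mw).
by split; [apply: le_m mx my _ | apply: le_m my mx _; rewrite mulrC].
Qed.

Section ISDBounds.

Set Implicit Arguments.
Unset Strict Implicit.

Variables (R : realType) (T : finType) (e : rel T).
Hypotheses (simple_e : simple_graph e) (no_iso_e : no_isolated e).

Let d u : R := (degree e u)%:R.

Lemma degreeR_gt0 u : 0 < d u.
Proof. by rewrite ltr0n; exact: degree_gt0. Qed.

Lemma edge_sum u v (F : T -> R) :
  e u v -> \sum_(w in [set u; v]) F w = F u + F v.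
Proof.
case: simple_e => _ _ irr_e euv; rewrite big_setU1 ?big_set1 // inE.
by apply: contraTneq euv => ->; rewrite irr_e.
Qed.

Lemma powRN2 (a x : R) : x `^ (- (2 * a)) = (x `^ (- a)) ^+ 2.
Proof. by rewrite -powR_mulrn ?powR_ge0 // -powRrM mulNr mulrC. Qed.

Lemma edge_term_leif (a : R) (m : nat) f :
  (0 < m)%N -> (forall u, m%:R `^ (- a) <= d u `^ (- a)) -> f \in edges e ->
  m%:R `^ (- (2 * a)) * (1 / \sum_(w in f) d w `^ (- a))
    <= 1 / \sum_(w in f) d w `^ a
    ?= iff [forall w in f, d w `^ (- a) == m%:R `^ (- a)].
Proof.
move=> m0 md /imsetP[[u v]]; rewrite inE /= => euv ->.
have dV w : d w `^ a = (d w `^ (- a))^-1 by rewrite -powRN opprK.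
rewrite !edge_sum // powRN2 !dV.
have -> : [forall w in [set u; v], d w `^ (- a) == m%:R `^ (- a)] =
    (d u `^ (- a) == m%:R `^ (- a)) && (d v `^ (- a) == m%:R `^ (- a)).
  apply/forall_inP/andP => [dm | [du dv] w].
    by split; apply: dm; rewrite !inE eqxx ?orbT.
  by rewrite !inE => /orP[] /eqP->.
by apply: leif_inv_sum; rewrite ?powR_gt0 ?ltr0n.
Qed.

(** When the extreme value m^(-a) is attained at a vertex, having all degrees
    equal to m is the same as regularity; a <> 0 makes x |-> x^(-a) injective,
    so that equality of powers gives equality of degrees. *)
Lemma ISD_lower_bound (a : R) (m : nat) :
  a != 0 -> (exists u, degree e u = m) ->
  (forall u, m%:R `^ (- a) <= d u `^ (- a)) ->
  m%:R `^ (- (2 * a)) * ISD e (- a) <= ISD e a /\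
  (m%:R `^ (- (2 * a)) * ISD e (- a) = ISD e a <-> regular e).
Proof.
move=> a0 [u0 u0m] md.
have m0 : (0 < m)%N by rewrite -u0m degree_gt0.
rewrite /ISD mulr_sumr.
have := leif_sum (fun f => @edge_term_leif a m f m0 md).
case=> -> eqE; split=> //; split.
- move/eqP; rewrite eqE => /forall_inP dm.
  suff deg_m u : degree e u = m by move=> u v; rewrite !deg_m.
  have [v euv] := no_iso_e u.
  have /dm/forall_inP/(_ u) : [set u; v] \in edges e.
    by apply/imsetP; exists (u, v); rewrite ?inE.
  rewrite !inE eqxx => /(_ isT) /eqP.
  move=> du; apply/eqP; rewrite -(eqr_nat R); apply/eqP.
  by apply: powR_inj_neq0 du; rewrite ?oppr_eq0 ?degreeR_gt0 ?ltr0n.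
- move=> reg; apply/eqP; rewrite eqE; apply/forall_inP=> f _.
  by apply/forall_inP=> w _; rewrite /d (reg w u0) u0m.
Qed.

Lemma ISD_upper_bound (a : R) (m : nat) :
  a != 0 -> (exists u, degree e u = m) ->
  (forall u, m%:R `^ a <= d u `^ a) ->
  ISD e a <= m%:R `^ (- (2 * a)) * ISD e (- a) /\
  (ISD e a = m%:R `^ (- (2 * a)) * ISD e (- a) <-> regular e).
Proof.
move=> a0 m_attained md.
have m0 : (0 < m)%N by case: m_attained => u <-; rewrite degree_gt0.
have := @ISD_lower_bound (- a) m; rewrite oppr_eq0 opprK mulrN opprK.
case=> // le_ISD eq_ISD.
have p0 : 0 < m%:R `^ (2 * a) :> R by rewrite powR_gt0 ?ltr0n.
rewrite powRN mulrC ler_pdivlMr // [ISD e a * _]mulrC; split=> //.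
rewrite -eq_ISD; split=> [-> | <-].
  by rewrite mulrCA divff ?mulr1 ?gt_eqF.
by rewrite mulrAC divff ?mul1r ?gt_eqF.
Qed.

End ISDBounds.

Theorem theorem2 (R : realType) (T : finType) (e : rel T)
    (simple_e : simple_graph e) (no_iso_e : no_isolated e) (a : R) :
  let delta : R := (min_degree e)%:R in
  let Delta : R := (max_degree e)%:R in
  (0 < a ->
    [/\ Delta `^ (- (2 * a)) * ISD e (- a) <= ISD e a
          <= delta `^ (- (2 * a)) * ISD e (- a),
        Delta `^ (- (2 * a)) * ISD e (- a) = ISD e a <-> regular e &
        ISD e a = delta `^ (- (2 * a)) * ISD e (- a) <-> regular e]) /\
  (a < 0 ->
    [/\ delta `^ (- (2 * a)) * ISD e (- a) <= ISD e a
          <= Delta `^ (- (2 * a)) * ISD e (- a),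
        delta `^ (- (2 * a)) * ISD e (- a) = ISD e a <-> regular e &
        ISD e a = Delta `^ (- (2 * a)) * ISD e (- a) <-> regular e]).
Proof.
move=> delta Delta.
have min_le u : delta <= (degree e u)%:R by rewrite ler_nat min_degree_le.
have le_max u : (degree e u)%:R <= Delta by rewrite ler_nat max_degree_ge.
have min_att := min_degree_attained simple_e.
have max_att := max_degree_attained simple_e.
have powR_incr (b x y : R) : 0 < b -> 0 <= x -> x <= y -> x `^ b <= y `^ b.
  by move=> b0 x0 xy; apply: ge0_ler_powR; rewrite ?nnegrE ?(le_trans x0 xy) ?(ltW b0).
have powR_decr (b x y : R) : 0 < b -> 0 < x -> x <= y -> y `^ (- b) <= x `^ (- b).
  move=> b0 x0 xy; have y0 := lt_le_trans x0 xy.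
  by rewrite !powRN lef_pV2 ?posrE ?powR_gt0 // powR_incr // ltW.
have d0 := degreeR_gt0 R no_iso_e.
split=> a_sgn; have a0 : a != 0 by rewrite ?(gt_eqF a_sgn) ?(lt_eqF a_sgn).
- have [|-> eqD] := ISD_lower_bound simple_e no_iso_e a0 max_att.
    by move=> u; apply: powR_decr.
  have [|-> eqd] := ISD_upper_bound simple_e no_iso_e a0 min_att; last by [].
  by move=> u; apply: powR_incr.
- have Na_gt0 : 0 < - a by rewrite oppr_gt0.
  have [|-> eqd] := ISD_lower_bound simple_e no_iso_e a0 min_att.
    by move=> u; apply: powR_incr.
  have [|-> eqD] := ISD_upper_bound simple_e no_iso_e a0 max_att; last by [].
  by move=> u; rewrite -[a]opprK; apply: powR_decr.
Qed.
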